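(* Let $\phi:\mathbb{R}^{n+1}\to\mathbb{R}$ be $C^3$ and let $f(x)=\phi(Bx)$ with $B\in\mathbb{R}^{(n+1)\times(n+1)}$ invertible and $\det B>0$. Let $\{x_k\}$ be generated by YAND with exact line search $$x_{k+1}=x_k+\alpha_kd^f_{\mathrm{AN}}(x_k),\qquad\alpha_k\in\arg\min_{\alpha>0}f\bigl(x_k+\alpha d^f_{\mathrm{AN}}(x_k)\bigr).$$ Define $y_k:=Bx_k$. Assume that along the iterates the affine normal directions are well defined for $f$ at $x_k$ and for $\phi$ at $y_k$ (e.g. the relevant level sets are elliptic). Then $\{y_k\}$ coincides with the YAND iterates (with exact line search) applied directly to $\phi$: $$y_{k+1}=y_k+\beta_kd^\phi_{\mathrm{AN}}(y_k),\qquad\beta_k\in\arg\min_{\beta>0}\phi\bigl(y_k+\beta d^\phi_{\mathrm{AN}}(y_k)\bigr).$$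
   Context: Affine normal direction. For a $C^3$ function $h:\mathbb{R}^{n+1}\to\mathbb{R}$ and a point $x$ with $\nabla h(x)\ne0$, put $e_{n+1}=\nabla h(x)/\|\nabla h(x)\|$ and let $e_1,\dots,e_n$ be an orthonormal basis of $\nabla h(x)^\perp$. For $i,j,p,q\le n$ write $h_{ij}=D^2h(x)[e_i,e_j]$, $h_{n+1,i}=D^2h(x)[e_{n+1},e_i]$, $h_{pqi}=D^3h(x)[e_p,e_q,e_i]$. The affine normal direction is well defined at $x$ when the tangent-tangent block $(h_{ij})_{i,j\le n}$ is invertible, with inverse $(h^{ij})$ ($x$ is elliptic if this block is positive definite); it is then, with the inward (descent) orientation and up to a positive scalar, $$d^h_{\mathrm{AN}}(x)\propto\sum_{i}\Big(\sum_{j}h^{ij}\Big(-\tfrac1{n+2}\|\nabla h(x)\|\sum_{p,q}h^{pq}h_{pqj}+h_{n+1,j}\Big)\Big)e_i-e_{n+1}.$$ *)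

(* Defs.v *)
From mathcomp Require Import all_boot all_order all_algebra.
From mathcomp Require Import all_classical all_reals all_analysis.
Import Order.TTheory GRing.Theory Num.Theory.
Import numFieldNormedType.Exports.

Set Implicit Arguments.
Unset Strict Implicit.
Unset Printing Implicit Defensive.

Local Open Scope ring_scope.

(* C^k on the whole space: in finite dimension, h is C^(k+1) iff it is
   differentiable and all its directional derivatives are C^k. *)
Fixpoint Ck (R : realType) (m : nat) (k : nat) (h : 'cV[R]_m.+1 -> R) : Prop :=
  match k with
  | 0 => continuous h
  | k'.+1 => (forall x, differentiable h x) /\
             (forall v, Ck k' (fun x => 'D_v h x))
  end.

(* The norm that MathComp-Analysis puts on matrices is the sup norm, so the
   Euclidean structure is introduced separately. *)
Definition dot (R : realType) (m : nat) (u v : 'cV[R]_m) : R :=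
  \sum_i u i 0 * v i 0.

Definition enorm (R : realType) (m : nat) (u : 'cV[R]_m) : R :=
  Num.sqrt (dot u u).

Section AffineNormal.
Context {R : realType} {n : nat}.
Implicit Types (h : 'cV[R]_n.+1 -> R) (x u v w d : 'cV[R]_n.+1).

Definition grad h x : 'cV[R]_n.+1 := \col_i 'D_(delta_mx i 0) h x.

Definition D2 h x u v : R := 'D_u (fun y => 'D_v h y) x.

Definition D3 h x u v w : R := 'D_u (fun z => 'D_v (fun y => 'D_w h y) z) x.

(* e_(n+1) *)
Definition unit_normal h x : 'cV[R]_n.+1 := (enorm (grad h x))^-1 *: grad h x.

(* n orthonormal vectors of the n-dimensional space orthogonal to the gradient
   form an orthonormal basis of it. *)
Definition tangent_frame h x (e : 'I_n -> 'cV[R]_n.+1) : Prop :=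
  (forall i j, dot (e i) (e j) = (i == j)%:R) /\
  (forall i, dot (e i) (grad h x) = 0).

(* (h_ij) *)
Definition tangent_block h x (e : 'I_n -> 'cV[R]_n.+1) : 'M[R]_n :=
  \matrix_(i, j) D2 h x (e i) (e j).

Definition AN_frame h x (e : 'I_n -> 'cV[R]_n.+1) : Prop :=
  [/\ grad h x != 0, tangent_frame h x e & tangent_block h x e \in unitmx].

(* For a C^2 function, the invertibility of the block does not depend on the
   orthonormal basis chosen. *)
Definition AN_well_defined h x : Prop := exists e, AN_frame h x e.

Definition AN_formula h x (e : 'I_n -> 'cV[R]_n.+1) : 'cV[R]_n.+1 :=
  let hinv := invmx (tangent_block h x e) in
  \sum_i (\sum_j hinv i j *
            (- (n.+2%:R)^-1 * enorm (grad h x) *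
               (\sum_p \sum_q hinv p q * D3 h x (e p) (e q) (e j))
             + D2 h x (unit_normal h x) (e j))) *: e i
  - unit_normal h x.

(* The affine normal direction is only determined up to a positive scalar:
   d is one of its representatives. *)
Definition is_AN_direction h x d : Prop :=
  exists e (c : R), [/\ AN_frame h x e, 0 < c & d = c *: AN_formula h x e].

(* a is in argmin_(b > 0) h (x + b d) *)
Definition exact_line_search h x d (a : R) : Prop :=
  0 < a /\ (forall b : R, 0 < b -> h (x + a *: d) <= h (x + b *: d)).

(* z is a sequence of YAND iterates for h, with directions d and steps a *)
Definition YAND_iterates h (d : nat -> 'cV[R]_n.+1) (a : nat -> R)
    (z : nat -> 'cV[R]_n.+1) : Prop :=
  forall k, [/\ is_AN_direction h (z k) (d k),
                exact_line_search h (z k) (d k) (a k)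
              & z k.+1 = z k + a k *: d k].

End AffineNormal.

(* Main.v *)
Require Import Defs.
From mathcomp Require Import all_boot all_order all_algebra.
From mathcomp Require Import all_classical all_reals all_analysis.
From mathcomp Require Import ring lra.
Import Order.TTheory GRing.Theory Num.Theory.
Import numFieldNormedType.Exports.

(* Split a representative [d] of the affine normal direction into its tangent
   part and its normal part.  The tangent part is obtained by solving a linear
   system whose right-hand side contains [h_(n+1,j)]; moving this term to the
   left turns the formula into
     [D2 h (w, d) = (D_d h / (n+2)) * tr_A (D3 h (., ., w))]  for [w] tangent,
   together with [D_d h < 0], where [A] is the tangent Hessian.  This makes sense
   in any basis of the tangent space, without any Euclidean structure, hence it
   is transported by [B]; and it determines [d] up to a positive factor.  So
   [B d^f] and [d^phi] are positively proportional, and the steps are rescaled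
   by that factor.  The symmetry of the Hessian is what allows the Euclidean
   normal to be replaced by another transversal. *)

Set Implicit Arguments.
Unset Strict Implicit.
Unset Printing Implicit Defensive.

Local Open Scope ring_scope.

(** * Linear functionals and directional derivatives *)

Lemma scalar_zero (R : realType) (V : lmodType R) (L : V -> R) :
  scalar L -> L 0 = 0.
Proof.
move=> hL; have := hL 1 0 0.
rewrite scaler0 addr0 mul1r; lra.
Qed.

Lemma scalar_scale (R : realType) (V : lmodType R) (L : V -> R) a u :
  scalar L -> L (a *: u) = a * L u.
Proof. by move=> hL; rewrite -[a *: u]addr0 hL (scalar_zero hL) addr0. Qed.

Lemma scalar_sum (R : realType) (V : lmodType R) (L : V -> R) (I : finType)
    (c : I -> R) (u : I -> V) :
  scalar L -> L (\sum_i c i *: u i) = \sum_i c i * L (u i).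
Proof.
move=> hL; elim/big_rec2: _ => [|i y1 y2 _ <-]; first exact: scalar_zero.
by rewrite hL.
Qed.

Lemma derive_scalar (R : realType) (V : normedModType R) (h : V -> R) (x : V) :
  differentiable h x -> scalar (fun v => 'D_v h x).
Proof. by move=> hd a u v /=; rewrite !deriveE // linearP. Qed.

Lemma derive_lincomb (R : realType) (V : normedModType R) (f g : V -> R)
    (a : R) (x v : V) : differentiable f x -> differentiable g x ->
  'D_v (fun y => a * f y + g y) x = a * 'D_v f x + 'D_v g x.
Proof.
move=> df dg; have := @deriveD _ _ _ (a \*: f) g x v.
rewrite deriveZ; last exact: diff_derivable.
by apply; apply: diff_derivable => //; apply: differentiableZ.
Qed.

(** * Mean values along lines and symmetry of second derivatives *)

Lemma is_derive_line (R : realType) (V : normedModType R) (h : V -> R)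
    (z v : V) (t : R) : differentiable h (z + t *: v) ->
  is_derive t (1 : R) (fun t : R => h (z + t *: v)) ('D_v h (z + t *: v)).
Proof.
move=> dh.
have eqq : (fun k : R => k^-1 *: (((fun t : R => h (z + t *: v)) \o shift t) (k *: (1:R)) - h (z + t *: v)))
   = (fun k : R => k^-1 *: ((h \o shift (z + t *: v)) (k *: v) - h (z + t *: v))).
  apply/funext => k /=; congr (_ *: (h _ - _)).
  by rewrite -[k *: 1]/(k * 1) mulr1 scalerDl addrCA.
have dv := diff_derivable dh (v := v).
split; last by rewrite /derive eqq.
by rewrite /derivable eqq; apply: dv.
Qed.

Lemma line_MVT (R : realType) (g dg : R -> R) (s : R) : 0 < s ->
  (forall t, is_derive t (1 : R) g (dg t)) ->
  exists2 c, 0 <= c <= s & g s - g 0 = s * dg c.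
Proof.
move=> s0 dg'; have [|c] := MVT (f := g) (df := dg) s0 (fun t _ => dg' t).
  by apply: derivable_within_continuous => t _; case: (dg' t).
by rewrite in_itv /= subr0 mulrC => /andP[/ltW c0 /ltW cs] ->; exists c => //; rewrite c0.
Qed.

Section SecondDifference.
Context {R : realType} {V : normedModType R}.
Variables (h : V -> R) (u v : V).
Hypothesis dh : forall z, differentiable h z.
Hypothesis dvh : forall z, differentiable (fun y => 'D_v h y) z.

(** The mean value theorem is used twice: along [v], for the difference of [h] on two parallel
    segments, then along [u], for ['D_v h]. *)
Lemma second_difference (x : V) (s : R) : 0 < s ->
  exists a b, [/\ 0 <= a <= s, 0 <= b <= s &
  h (x + s *: u + s *: v) - h (x + s *: u) - h (x + s *: v) + h x
  = s * s * 'D_u (fun y => 'D_v h y) (x + a *: u + b *: v)].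
Proof.
move=> s0.
have [b bs Eb] := line_MVT
  (g := fun t : R => h (x + s *: u + t *: v) - h (x + t *: v)) s0
  (fun t => is_deriveB (is_derive_line (v := v) (dh _)) (is_derive_line (z := x) (v := v) (dh _))).
have [a a_le_s Ea] := line_MVT
  (g := fun t : R => 'D_v h (x + b *: v + t *: u)) s0
  (fun t => is_derive_line (z := x + b *: v) (v := u) (dvh _)).
exists a, b; split; [exact: a_le_s | exact: bs |].
move: Ea Eb; rewrite !scale0r !addr0 !(addrAC x (b *: v)) => Ea.
rewrite Ea => Eb.
rewrite -mulrA -Eb opprB addrA [in RHS]addrAC; congr (_ + h x); exact: addrAC.
Qed.

End SecondDifference.

Lemma near_line_pair (R : realType) (V : normedModType R) (g : V -> R)
    (x u v : V) (e : R) : {for x, continuous g} -> 0 < e ->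
  exists2 d : R, 0 < d & forall s a b, s <= d -> 0 <= a <= s -> 0 <= b <= s ->
    `|g x - g (x + a *: u + b *: v)| < e.
Proof.
move=> gc e0; have near_x : nbhs x [set y | `|g x - g y| < e]%classic.
  exact: (cvgr_dist_lt _ _ gc _ e0).
have /nbhs_ballP[r /= r0 hr] := near_x.
(* The extra 1 keeps the denominator positive when [u] and [v] vanish, and makes the final bound
   strict when [s] is nonzero. *)
have p0 : 0 < `|u| + `|v| + 1 by rewrite ltr_wpDl // addr_ge0.
exists (r / (`|u| + `|v| + 1)); first exact: divr_gt0.
move=> s a b sd /andP[a0 a_le_s] /andP[b0 bs]; apply: hr.
rewrite -ball_normE /ball_ /= -addrA opprD addrA subrr add0r normrN.
apply: le_lt_trans (ler_normD _ _) _; rewrite !normrZ !ger0_norm //.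
have s0 : 0 <= s := le_trans a0 a_le_s.
apply: (@le_lt_trans _ _ (s * (`|u| + `|v|))).
  by rewrite mulrDr lerD // ler_wpM2r.
have [->|sN0] := eqVneq s 0; first by rewrite mul0r.
apply: (@lt_le_trans _ _ (s * (`|u| + `|v| + 1))).
  by rewrite ltr_pM2l ?ltrDl // lt_def sN0.
by rewrite -ler_pdivlMr.
Qed.

(** The second difference is symmetric in [u] and [v], so the two mixed derivatives take a common
    value at two points close to [x]; continuity brings both back to [x]. *)
Lemma derive_sym (R : realType) (V : normedModType R) (h : V -> R) (x u v : V) :
  (forall z, differentiable h z) ->
  (forall w z, differentiable (fun y => 'D_w h y) z) ->
  (forall w w', continuous (fun y => 'D_w (fun z => 'D_w' h z) y)) ->
  'D_u (fun y => 'D_v h y) x = 'D_v (fun y => 'D_u h y) x.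
Proof.
move=> dh ddh ch; apply/eqP; rewrite -subr_eq0 -normr_le0; apply/ler_addgt0Pl => e e0.
rewrite addr0; have e20 : 0 < e / 2 by rewrite divr_gt0.
have [d1 d10 h1] := near_line_pair u v (ch u v x) e20.
have [d2 d20 h2] := near_line_pair v u (ch v u x) e20.
set s := Num.min d1 d2; have s0 : 0 < s by rewrite lt_min d10.
have [a [b [ha hb E1]]] := second_difference u dh (ddh v) x s0.
have [a' [b' [ha' hb' E2]]] := second_difference v dh (ddh u) x s0.
have := h1 s a b; rewrite ge_min lexx => /(_ isT ha hb) {}h1.
have := h2 s a' b'; rewrite ge_min lexx orbT => /(_ isT ha' hb') {}h2.
have E : 'D_u (fun y => 'D_v h y) (x + a *: u + b *: v) =
   'D_v (fun y => 'D_u h y) (x + a' *: v + b' *: u).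
  have ss : s * s != 0 by rewrite mulf_neq0 ?gt_eqF.
  apply: (mulfI ss).
  apply: (etrans (esym E1)); apply: (etrans _ E2).
  by rewrite (addrAC x (s *: v)); congr (_ + h x); exact: addrAC.
apply/ltW/(le_lt_trans (ler_distD ('D_v (fun y => 'D_u h y) (x + a' *: v + b' *: u)) _ _)).
rewrite [e in _ < e]splitr; apply: ltrD; last by rewrite distrC; exact: h2.
by rewrite -E; exact: h1.
Qed.

(** * Multilinearity of the second and third derivatives *)

Section Jet.
Context {R : realType} {n : nat}.
Implicit Types (h : 'cV[R]_n.+1 -> R) (x u v w d : 'cV[R]_n.+1).

Lemma grad_dot h x v : scalar (fun v => 'D_v h x) -> 'D_v h x = dot (grad h x) v.
Proof.
move=> hD; rewrite {1}(matrix_sum_delta v) /=.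
under eq_bigr do rewrite big_ord1.
rewrite (scalar_sum _ _ hD).
by apply: eq_bigr => i _; rewrite mxE mulrC.
Qed.

Lemma D2_scalarl h x v : Ck 2 h -> scalar (fun u => D2 h x u v).
Proof. move=> [_ h2]; exact: derive_scalar ((h2 v).1 x). Qed.

Lemma derive_lincomb_dir h a u v : (forall z, differentiable h z) ->
  (fun z => 'D_(a *: u + v) h z) = (fun z => a * 'D_u h z + 'D_v h z).
Proof. by move=> dh; apply/funext => z; rewrite (derive_scalar (dh z)). Qed.

Lemma D2_scalarr h x u : Ck 2 h -> scalar (D2 h x u).
Proof.
move=> [dh h2] a v w; rewrite /D2 (derive_lincomb_dir _ _ _ dh).
exact: derive_lincomb ((h2 v).1 x) ((h2 w).1 x).
Qed.

Lemma D2_sym h x u v : Ck 2 h -> D2 h x u v = D2 h x v u.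
Proof.
move=> [dh h2].
exact: (derive_sym x u v dh (fun w => (h2 w).1) (fun w w' => (h2 w').2 w)).
Qed.

Lemma D3_scalarl h x v w : Ck 3 h -> scalar (fun u => D3 h x u v w).
Proof.
move=> [_ h2]; have [_ h3] := h2 w; exact: derive_scalar ((h3 v).1 x).
Qed.

Lemma D3_scalarm h x u w : Ck 3 h -> scalar (fun v => D3 h x u v w).
Proof. move=> [_ h2]; exact: (D2_scalarr x u (h2 w)). Qed.

Lemma D3_scalarr h x u v : Ck 3 h -> scalar (D3 h x u v).
Proof.
move=> [dh h2] a w w'; rewrite /D3 (derive_lincomb_dir _ _ _ dh).
have [[d1 h3] [d1' h3']] := (h2 w, h2 w').
have -> : (fun z => 'D_v (fun y => a * 'D_w h y + 'D_w' h y) z) =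
  (fun z => a * 'D_v (fun y => 'D_w h y) z + 'D_v (fun y => 'D_w' h y) z).
  by apply/funext => z; exact: derive_lincomb (d1 z) (d1' z).
exact: derive_lincomb ((h3 v).1 x) ((h3' v).1 x).
Qed.

End Jet.

(** * Derivatives under a linear change of variables *)

Lemma derive_mulmx (R : realType) (n : nat) (phi f : 'cV[R]_n.+1 -> R)
    (B : 'M[R]_n.+1) (hf : forall z, f z = phi (B *m z)) v x :
  'D_v f x = 'D_(B *m v) phi (B *m x).
Proof.
have E : (fun k : R => k^-1 *: ((f \o shift x) (k *: v) - f x)) =
    (fun k => k^-1 *: ((phi \o shift (B *m x)) (k *: (B *m v)) - phi (B *m x))).
  by apply/funext => k /=; rewrite !hf mulmxDr scalemxAr.
by rewrite /derive E.
Qed.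

Section LinearChange.
Context {R : realType} {n : nat}.
Variables (phi f : 'cV[R]_n.+1 -> R) (B : 'M[R]_n.+1).
Hypothesis hf : forall z, f z = phi (B *m z).

Lemma D2_mulmx x u v : D2 f x u v = D2 phi (B *m x) (B *m u) (B *m v).
Proof.
exact: (derive_mulmx (phi := fun y => 'D_(B *m v) phi y) (derive_mulmx hf v) u x).
Qed.

Lemma D3_mulmx x u v w :
  D3 f x u v w = D3 phi (B *m x) (B *m u) (B *m v) (B *m w).
Proof.
exact: (derive_mulmx (phi := fun z => D2 phi z (B *m v) (B *m w))
  (fun z => D2_mulmx z v w) u x).
Qed.
End LinearChange.

(** * Euclidean norm *)

Section Enorm.
Context {R : realType} {m : nat}.
Implicit Types u v : 'cV[R]_m.

Lemma dotC u v : dot u v = dot v u.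
Proof. by apply: eq_bigr => i _; rewrite mulrC. Qed.

Lemma dot_gt0 u : u != 0 -> 0 < dot u u.
Proof.
move=> u0; rewrite lt_def sumr_ge0 ?andbT; last by move=> i _; rewrite -expr2 sqr_ge0.
apply: contra u0; rewrite psumr_eq0; last by move=> i _; rewrite -expr2 sqr_ge0.
move=> /allP u0; apply/eqP/matrixP => i j; rewrite ord1 mxE.
by have /u0 := mem_index_enum i; rewrite mulf_eq0 orbb => /eqP.
Qed.

Lemma enorm_gt0 u : u != 0 -> 0 < enorm u.
Proof. by move=> /dot_gt0; rewrite sqrtr_gt0. Qed.

Lemma enorm_sqr u : enorm u * enorm u = dot u u.
Proof.
by rewrite -expr2 sqr_sqrtr // sumr_ge0 // => i _; rewrite -expr2 sqr_ge0.
Qed.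

End Enorm.

(** * Linear systems, traces and change of basis *)

Lemma invmx_solve (R : realType) (n : nat) (A : 'M[R]_n) (b : 'I_n -> R) k :
  A \in unitmx -> \sum_i (\sum_j invmx A i j * b j) * A k i = b k.
Proof.
move=> hA; pose c : 'cV[R]_n := \col_j b j.
have := congr1 (fun M : 'cV_n => M k 0) (mulKVmx hA c); rewrite !mxE => <-.
apply: eq_bigr => i _; rewrite mulrC !mxE; congr (_ * _).
by apply: eq_bigr => j _; rewrite !mxE.
Qed.

Lemma trace_pairing (R : realType) (n : nat) (M N : 'M[R]_n) :
  \sum_p \sum_q M p q * N p q = \tr (M^T *m N).
Proof.
rewrite /mxtrace exchange_big /=; apply: eq_bigr => q _; rewrite mxE.
by apply: eq_bigr => p _; rewrite mxE.
Qed.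

(** Serves both for the tangent Hessian and for [D3 h x] with its last argument fixed, so that the
    same [P] acts on both by congruence. *)
Lemma gram_change (R : realType) (V : lmodType R) (n : nat) (b : V -> V -> R)
    (e e' : 'I_n -> V) (P : 'M[R]_n) :
  (forall v, scalar (b^~ v)) -> (forall u, scalar (b u)) ->
  (forall i, e' i = \sum_a P i a *: e a) ->
  \matrix_(i, j) b (e' i) (e' j) = P *m (\matrix_(i, j) b (e i) (e j)) *m P^T.
Proof.
move=> bl br he; apply/matrixP => i j; rewrite -mulmxA !mxE he (scalar_sum _ _ (bl _)).
apply: eq_bigr => a _; rewrite !mxE he (scalar_sum _ _ (br _)); congr (_ * _).
by apply: eq_bigr => c _; rewrite !mxE mulrC.
Qed.

Lemma invmx_congruence (R : realType) (n : nat) (A A' P : 'M[R]_n) :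
  A \in unitmx -> A' \in unitmx -> A' = P *m A *m P^T ->
  P^T *m invmx A' *m P = invmx A.
Proof.
(* Invertibility of [P] is inherited from that of [A']. *)
move=> hA hA' E; have hP : P^T \in unitmx by move: hA'; rewrite E unitmx_mul => /andP[].
rewrite -[RHS]mul1mx; apply: (canRL (mulmxK hA)).
have -> : P^T *m invmx A' *m P *m A = P^T *m invmx A' *m (P *m A *m P^T) *m invmx P^T.
  by rewrite !mulmxA mulmxK.
by rewrite -E -(mulmxA P^T) mulVmx // mulmx1 mulmxV.
Qed.

(** The inverse transforms contragrediently to [N], so the factors [P] cancel by cyclicity of the
    trace: a trace relative to the tangent Hessian does not depend on the frame. *)
Lemma mxtrace_congruence (R : realType) (n : nat) (A A' N N' P : 'M[R]_n) :
  A \in unitmx -> A' \in unitmx -> A' = P *m A *m P^T -> N' = P *m N *m P^T ->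
  \tr ((invmx A')^T *m N') = \tr ((invmx A)^T *m N).
Proof.
move=> hA hA' EA ->; rewrite -(invmx_congruence hA hA' EA) !trmx_mul trmxK.
by rewrite !mulmxA mxtrace_mulC !mulmxA.
Qed.

(** * The affine normal equation, its invariance and its uniqueness *)

Section Equation.
Context {R : realType} {n : nat}.
Implicit Types (h : 'cV[R]_n.+1 -> R) (x u v w d : 'cV[R]_n.+1) (e : 'I_n -> 'cV[R]_n.+1).

Lemma Ck3_Ck2 h : Ck 3 h -> Ck 2 h.
Proof.
move=> [dh h2]; split=> // v; have [dv h1] := h2 v; split=> // w z.
by apply: differentiable_continuous; have [] := h1 w.
Qed.

Definition cubic_trace h x e w : R :=
  \sum_p \sum_q invmx (tangent_block h x e) p q * D3 h x (e p) (e q) w.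

(** The frame lies in the kernel of the differential but need not be orthonormal, a condition that
    [B] preserves. Both sides of the last clause are linear in [d], so the scale of [d] is free. *)
Definition AN_equation h x e d : Prop :=
  [/\ forall i, 'D_(e i) h x = 0, tangent_block h x e \in unitmx,
      'D_d h x < 0
    & forall i, D2 h x (e i) d = 'D_d h x / n.+2%:R * cubic_trace h x e (e i)].

(** Linearity and symmetry are hypotheses here, so that for [f] they can be read off from [phi]
    through [B], without a proof that [f] is of class C^3. *)
Lemma AN_formula_equation h x e (c : R) :
  scalar (fun v => 'D_v h x) -> (forall u, scalar (D2 h x u)) ->
  (forall u v, D2 h x u v = D2 h x v u) ->
  AN_frame h x e -> 0 < c -> AN_equation h x e (c *: AN_formula h x e).
Proof.
move=> lD lD2 D2C [g0 [_ eg] hA] c0.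
have N0 := enorm_gt0 g0; have NN := enorm_sqr (grad h x); set N := enorm _ in N0 NN.
have De i : 'D_(e i) h x = 0 by rewrite grad_dot // dotC.
have Dun : 'D_(unit_normal h x) h x = N.
  by rewrite (scalar_scale _ _ lD) grad_dot // -NN mulrA mulVf ?mul1r ?gt_eqF.
have [t [-> ht]] : exists t : 'I_n -> R,
    AN_formula h x e = - 1 *: unit_normal h x + \sum_i t i *: e i /\
    t = fun i => \sum_j invmx (tangent_block h x e) i j *
      (- (n.+2%:R)^-1 * N * cubic_trace h x e (e j) + D2 h x (unit_normal h x) (e j)).
  by eexists; split; last reflexivity; rewrite scaleN1r addrC.
(* The tangent part is killed by the differential, so ['D_d h x] takes the place of minus the norm
   of the gradient. *)
have DAN : 'D_(- 1 *: unit_normal h x + \sum_i t i *: e i) h x = - N.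
  rewrite (lD (-1)) Dun (scalar_sum _ _ lD) big1 ?addr0 ?mulN1r // => i _.
  by rewrite De mulr0.
split=> // [|k].
  by rewrite (scalar_scale _ _ lD) DAN mulrN oppr_lt0 mulr_gt0.
rewrite (scalar_scale _ _ lD) DAN (scalar_scale _ _ (lD2 _)) (lD2 (e k)) (scalar_sum _ _ (lD2 _)).
have -> : \sum_i t i * D2 h x (e k) (e i) =
    \sum_i t i * tangent_block h x e k i by apply: eq_bigr => i _; rewrite mxE.
(* Solving the system leaves the mixed term [D2 h x (unit_normal h x) (e k)], which by symmetry
   cancels the contribution of the normal part. *)
rewrite ht invmx_solve // (D2C (e k)) /=; ring.
Qed.

Lemma AN_equation_mulmx (phi f : 'cV[R]_n.+1 -> R) (B : 'M[R]_n.+1) x e d :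
  (forall z, f z = phi (B *m z)) -> AN_equation f x e d ->
  AN_equation phi (B *m x) (fun i => B *m e i) (B *m d).
Proof.
move=> hf [De hA Dd E].
have EA : tangent_block phi (B *m x) (fun i => B *m e i) = tangent_block f x e.
  apply/matrixP => i j; rewrite [LHS]mxE [RHS]mxE; exact/esym/(D2_mulmx hf).
have ET w : cubic_trace phi (B *m x) (fun i => B *m e i) (B *m w) = cubic_trace f x e w.
  rewrite /cubic_trace EA; do 2!apply: eq_bigr => ? _.
  by rewrite -(D3_mulmx hf).
split=> [i|||i]; first by rewrite -(derive_mulmx hf).
- by rewrite EA.
- by rewrite -(derive_mulmx hf).
by rewrite -(D2_mulmx hf) -(derive_mulmx hf) E ET.
Qed.

(* [d] is transversal and [e] spans the tangent space: invertibility of the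
   tangent block makes the [e i] independent. *)
Lemma AN_equation_basis h x e d w :
  scalar (fun v => 'D_v h x) -> (forall u, scalar (D2 h x u)) ->
  AN_equation h x e d ->
  exists (r : 'I_n -> R) (s : R),
    w = s *: d + \sum_i r i *: e i /\ 'D_w h x = s * 'D_d h x.
Proof.
move=> lD lD2 [De hA Dd _].
have D0 (r : 'I_n -> R) s : 'D_(s *: d + \sum_i r i *: e i) h x = s * 'D_d h x.
  by rewrite (lD s) (scalar_sum _ _ lD) big1 ?addr0 // => i _; rewrite De mulr0.
(* The rows of [M] are [d] and the [e i]; once they are independent, [invmx M] gives the coordinates
   of [w]. *)
pose M : 'M[R]_n.+1 :=
  (col_mx d^T (\matrix_(i < n, j < n.+1) e i j 0) : 'M[R]_(1 + n, n.+1)).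
have comb (v : 'rV[R]_n.+1) : (v *m M)^T =
    (lsubmx (v : 'rV_(1 + n))) 0 0 *: d + \sum_i (rsubmx (v : 'rV_(1 + n))) 0 i *: e i.
  have -> : v *m M = lsubmx (v : 'rV_(1 + n)) *m d^T +
      rsubmx (v : 'rV_(1 + n)) *m (\matrix_(i < n, j < n.+1) e i j 0).
    by rewrite -mul_row_col hsubmxK.
  apply/colP => j; rewrite !mxE big_ord1 summxE !mxE; congr (_ + _).
  by apply: eq_bigr => i _; rewrite !mxE.
have Munit : M \in unitmx.
  rewrite -row_free_unit; apply: inj_row_free => v vM.
  have := comb v; rewrite vM trmx0; set s := lsubmx _ 0 0; set r := rsubmx _.
  (* The differential sees only [d] in a vanishing combination, so [s] is 0; pairing with each [e k]
     through [D2] then gives a homogeneous system for [r]. *)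
  move=> E0; have s0 : s = 0.
    have := D0 (r 0) s; rewrite -E0 (scalar_zero lD) => /esym/eqP.
    by rewrite mulf_eq0 (lt_eqF Dd) orbF => /eqP.
  have Ar : tangent_block h x e *m r^T = 0.
    apply/colP => k; rewrite [LHS]mxE [RHS]mxE.
    have := scalar_zero (lD2 (e k)).
    rewrite E0 s0 scale0r add0r (scalar_sum _ _ (lD2 _)) => E1; rewrite -[RHS]E1.
    by apply: eq_bigr => i _; rewrite [r^T _ _]mxE mxE mulrC.
  have r0 : r = 0 by rewrite -[r]trmxK -[r^T](mulKmx hA) Ar mulmx0 trmx0.
  have l0 : lsubmx (v : 'rV_(1 + n)) = 0.
    by apply/rowP => i; rewrite !ord1 -/s s0 mxE.
  by apply: etrans (esym (hsubmxK (v : 'rV_(1 + n)))) _; rewrite -/r r0 l0 row_mx0.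
have := comb (w^T *m invmx M); rewrite mulmxKV // trmxK => Ew.
by eexists; eexists; split; [exact: Ew | rewrite {1}Ew; exact: D0].
Qed.

(** Write [d'] as [s *: d] plus a tangent vector. The differential is negative on both directions,
    so [s] is positive; the equations, rewritten in one frame, force the tangent vector to
    vanish. *)
Lemma AN_equation_unique h x e e' d d' : Ck 3 h ->
  AN_equation h x e d -> AN_equation h x e' d' ->
  exists2 c : R, 0 < c & d' = c *: d.
Proof.
move=> h3 Ed Ed'; have h2 := Ck3_Ck2 h3.
have lD : scalar (fun v => 'D_v h x) by apply: derive_scalar; case: h3.
have lD2 u : scalar (D2 h x u) by exact: D2_scalarr.
have basis w := AN_equation_basis w lD lD2 Ed.
have [De hA Dd E] := Ed; have [De' hA' Dd' E'] := Ed'.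
have [r [s [Er Es]]] := basis d'.
have s0 : 0 < s by move: Dd'; rewrite Es nmulr_llt0.
(* The differential vanishes on [e' i] but not on [d], so [e' i] has no component along [d]. *)
have /choice[P hP] : forall i, exists q : 'I_n -> R, e' i = \sum_a q a *: e a.
  move=> i; have [q [s' [Eq Es']]] := basis (e' i); exists q; rewrite {1}Eq.
  move/esym/eqP: Es'; rewrite De' mulf_eq0 (lt_eqF Dd) orbF => /eqP ->.
  by rewrite scale0r add0r.
pose Pm : 'M[R]_n := \matrix_(i, a) P i a.
have hPm i : e' i = \sum_a Pm i a *: e a.
  by rewrite hP; apply: eq_bigr => a _; rewrite mxE.
have EA : tangent_block h x e' = Pm *m tangent_block h x e *m Pm^T.
  exact: (gram_change (b := D2 h x) (fun v => D2_scalarl x v h2) lD2 hPm).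
have ET w : cubic_trace h x e' w = cubic_trace h x e w.
  have tr e0 : cubic_trace h x e0 w = \tr ((invmx (tangent_block h x e0))^T *m
      \matrix_(p, q) D3 h x (e0 p) (e0 q) w).
    by rewrite -trace_pairing; do 2!apply: eq_bigr => ? _; rewrite mxE.
  rewrite (tr e') (tr e); apply: (mxtrace_congruence hA hA' EA).
  exact: (gram_change (b := fun u v => D3 h x u v w)
    (fun v => D3_scalarl x v w h3) (fun u => D3_scalarm x u w h3) hPm).
have Pu : Pm \in unitmx.
  by move: hA'; rewrite EA !unitmx_mul => /andP[/andP[]].
have lin3 : scalar (cubic_trace h x e).
  move=> a u v; rewrite /cubic_trace mulr_sumr -big_split; apply: eq_bigr => p _ /=.
  rewrite mulr_sumr -big_split; apply: eq_bigr => q _ /=.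
  by rewrite (D3_scalarr x _ _ h3 a) mulrDr mulrCA.
(* [z] is the defect of [d'] in the equations written in the frame [e]. *)
pose z a := D2 h x (e a) d' - 'D_d' h x / n.+2%:R * cubic_trace h x e (e a).
(* By linearity in the frame vector, the equations of [d'] in [e'] are the combinations by [Pm] of
   the defects in [e]. *)
have Pz : Pm *m (\col_a z a) = 0.
  apply/colP => i; rewrite [LHS]mxE [RHS]mxE.
  have := E' i; rewrite ET hPm (scalar_sum _ _ (D2_scalarl x d' h2)).
  rewrite (scalar_sum _ _ lin3) => /eqP; rewrite -subr_eq0 mulr_sumr -sumrB => /eqP E0.
  by rewrite -[RHS]E0; apply: eq_bigr => a _; rewrite [X in _ * X]mxE mulrBr (mulrCA (Pm i a)).
(* The part [s *: d] satisfies the equations with ['D_d' h x], so only the tangent part contributes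
   to the defect. *)
have zA : \col_a z a = tangent_block h x e *m \col_i r i.
  apply/colP => a; rewrite [LHS]mxE [RHS]mxE /z.
  rewrite {1}Er (lD2 (e a) s) E Es (scalar_sum _ _ (lD2 _)).
  rewrite mulrA mulrA addrAC subrr add0r.
  by apply: eq_bigr => i _; rewrite mulrC [X in _ = X * _]mxE [X in _ = _ * X]mxE.
have r0 : \col_i r i = 0.
  by rewrite -[LHS](mulKmx hA) -zA -[X in _ *m X](mulKmx Pu) Pz !mulmx0.
exists s => //; rewrite Er big1 ?addr0 // => i _.
have /colP/(_ i) := r0; rewrite [LHS]mxE [RHS]mxE => ->; exact: scale0r.
Qed.

End Equation.

(** * Equivariance of the iterates *)

Theorem theorem9p5 (R : realType) (n : nat)
    (phi f : 'cV[R]_n.+1 -> R) (B : 'M[R]_n.+1)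
    (hphi : Ck 3 phi)
    (hB : B \in unitmx) (hdet : 0 < \det B)
    (hf : forall z, f z = phi (B *m z))
    (x y df : nat -> 'cV[R]_n.+1) (alpha : nat -> R)
    (hx : YAND_iterates f df alpha x)
    (hy : forall k, y k = B *m x k)
    (wf : forall k, AN_well_defined f (x k))
    (wphi : forall k, AN_well_defined phi (y k))
    (dphi : nat -> 'cV[R]_n.+1)
    (hdphi : forall k, is_AN_direction phi (y k) (dphi k)) :
  exists beta : nat -> R, YAND_iterates phi dphi beta y.
Proof.
have h2 := Ck3_Ck2 hphi.
have lD z : scalar (fun v => 'D_v phi z) by apply: derive_scalar; case: hphi.
have dir k : exists2 c : R, 0 < c & B *m df k = c *: dphi k.
  have [e [c [fe c0 ->]]] := hdphi k.
  have [[e' [c' [fe' c'0 ->]]] _ _] := hx k.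
  have eqphi := AN_formula_equation (lD _) (fun u => D2_scalarr _ u h2)
    (fun u v => D2_sym _ u v h2) fe c0.
  apply: (AN_equation_unique hphi eqphi); rewrite hy.
  apply: (AN_equation_mulmx hf).
  apply: (AN_formula_equation _ _ _ fe' c'0).
  - by move=> a u v; rewrite !(derive_mulmx hf) mulmxDr -scalemxAr (lD _ a).
  - move=> u a v w; rewrite !(D2_mulmx hf) mulmxDr -scalemxAr.
    exact: (D2_scalarr _ _ h2 a).
  - by move=> u v; rewrite !(D2_mulmx hf); exact: D2_sym.
have /choice[c hc] : forall k, exists c : R, 0 < c /\ B *m df k = c *: dphi k.
  by move=> k; have [c] := dir k; exists c.
have along k (a : R) : phi (y k + (a * c k) *: dphi k) = f (x k + a *: df k).
  by rewrite hf mulmxDr -scalemxAr (hc k).2 scalerA hy.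
(* A step [a] along [df k] is mapped by [B] to a step [a * c k] along [dphi k]. *)
exists (fun k => alpha k * c k) => k; have [_ [a0 ls] xk] := hx k.
have [c0 Bd] := hc k; split=> //; last first.
  by rewrite !hy xk mulmxDr -scalemxAr Bd scalerA.
split=> [|b b0]; first exact: mulr_gt0.
(* A competing step [b] for [phi] is the competing step [b / c k] for [f], positive because [c k]
   is. *)
rewrite along -[b](divfK (lt0r_neq0 c0)) along.
by apply: ls; rewrite divr_gt0.
Qed.
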